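(* Let $\mathbf{T}=(T_1,\dots,T_d)\in\mathfrak{B}(\mathcal{H})^d$. Then for each $0\le\lambda\le1$, $$2\sqrt{\lambda-\lambda^2}\,\|\widetilde{\mathbf{T}}\|\le\|\mathbf{M}_\lambda(\mathbf{T})\|\le\lambda\|\mathbf{T}\|+(1-\lambda)\|\mathbf{T}^D\|\le\|\mathbf{T}\|.$$ In particular, for $\lambda=\frac12$, $\|\widetilde{\mathbf{T}}\|\le\|\widehat{\mathbf{T}}\|\le\|\mathbf{T}\|$.
   Context: $\mathcal{H}$ is a separable complex Hilbert space, $\mathfrak{B}(\mathcal{H})$ the bounded linear operators on $\mathcal{H}$, and $d\in\mathbb{N}$. The spherical (joint) operator norm of a tuple $\mathbf{T}=(T_1,\dots,T_d)\in\mathfrak{B}(\mathcal{H})^d$ is $\|\mathbf{T}\|=\sup\{(\sum_{k=1}^d\|T_kx\|^2)^{1/2}: x\in\mathcal{H},\ \|x\|=1\}$. Canonical spherical polar decomposition: $\mathbf{T}=\mathbf{V}P=(V_1P,\dots,V_dP)$, where $P=\sqrt{T_1^*T_1+\cdots+T_d^*T_d}$ and $\mathbf{V}=(V_1,\dots,V_d)$, viewed as a column operator $\mathcal{H}\to\mathcal{H}^d$, is the partial isometry with initial space $\mathcal{N}(P)^\perp$; that is, $T_i=V_iP$ for all $i$ and $\sum_{i=1}^dV_i^*V_i$ is the orthogonal projection onto $\mathcal{N}(P)^\perp=\overline{\mathcal{R}(P)}$. The spherical Aluthge transform is $\widetilde{\mathbf{T}}=(P^{1/2}V_1P^{1/2},\dots,P^{1/2}V_dP^{1/2})$;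 the spherical Duggal transform is $\mathbf{T}^D=(PV_1,\dots,PV_d)$; the spherical mean transform is $\widehat{\mathbf{T}}=\frac12(\mathbf{T}+\mathbf{T}^D)$; for $\lambda\in[0,1]$ the spherical $\lambda$-mean transform is $\mathbf{M}_\lambda(\mathbf{T})=\lambda\mathbf{T}+(1-\lambda)\mathbf{T}^D$ (coordinatewise operations). *)

(* Defs.v *)
From HB Require Import structures.
From mathcomp Require Import all_boot all_order all_algebra.
From mathcomp Require Import sesquilinear complex.
From mathcomp Require Import all_classical all_reals all_analysis.
Set Implicit Arguments.
Unset Strict Implicit.
Unset Printing Implicit Defensive.
Import Order.TTheory GRing.Theory Num.Theory.
Import numFieldNormedType.Exports.
Local Open Scope classical_set_scope.
Local Open Scope ring_scope.
Local Open Scope complex_scope.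

(* [inner] is linear in its first argument, conjugate-linear in its second. *)
Record hilbertSpace (R : realType) := HilbertSpace {
  hilbert_sort :> completeNormedModType R[i];
  inner : {dot hilbert_sort for Num.conj};
  inner_norm : forall x : hilbert_sort, inner x x = `|x| ^+ 2 }.

Definition separable_space (T : topologicalType) : Prop :=
  exists2 A : set T, countable A & dense A.

Section operators.
Context {R : realType} {H : hilbertSpace R}.
Implicit Types (A B P E : H -> H) (M : set H).

Definition bounded_op A : Prop :=
  linear A /\ bounded_near A (nbhs (0 : H)).

Definition is_adjoint A B : Prop :=
  bounded_op B /\ forall x y : H, inner H (A x) y = inner H x (B y).

(* The adjoint of a bounded operator exists and is unique (Riesz); the default
   value is only used for functions that are not bounded operators. *)
Definition adjoint A : H -> H := xget (fun=> 0) [set B | is_adjoint A B].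

(* In the order of [R[i]], [0 <= z] says that [z] is real and nonnegative. *)
Definition positive_op A : Prop := forall x : H, 0 <= inner H (A x) x.

Definition is_sqrt_op A P : Prop :=
  [/\ bounded_op P, positive_op P & P \o P = A].

(* Every positive bounded operator has exactly one positive square root. *)
Definition sqrt_op A : H -> H := xget (fun=> 0) [set P | is_sqrt_op A P].

Definition ker_op A : set H := [set x | A x = 0].

Definition orthocomp M : set H := [set y | forall x, M x -> inner H x y = 0].

Definition is_orthoproj E M : Prop :=
  forall x : H, M (E x) /\ orthocomp M (x - E x).

End operators.

Section spherical.
Context {R : realType} {H : hilbertSpace R} {d : nat}.
Implicit Types T V : 'I_d -> H -> H.

(* The norm of [H] takes its (real) values in [R[i]]. *)
Definition real_norm (x : H) : R := complex.Re `|x|.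

Definition spherical_norm T : R :=
  sup [set Num.sqrt (\sum_(k < d) real_norm (T k x) ^+ 2)
      | x in [set x : H | real_norm x = 1]].

Definition sum_adjoint_mul T : H -> H :=
  fun x => \sum_(k < d) adjoint (T k) (T k x).

Definition spherical_modulus T : H -> H := sqrt_op (sum_adjoint_mul T).

Definition is_spherical_polar_part T V : Prop :=
  let P := spherical_modulus T in
  [/\ forall k, bounded_op (V k),
      forall k, T k = V k \o P
    & is_orthoproj (sum_adjoint_mul V) (orthocomp (ker_op P))].

(* Such a [V] exists and is unique: it is prescribed on the closure of the range
   of [P], and vanishes on the kernel of [P]. *)
Definition spherical_polar_part T : 'I_d -> H -> H :=
  xget (fun _ _ => 0) [set V | is_spherical_polar_part T V].

Definition spherical_aluthge T : 'I_d -> H -> H :=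
  let Q := sqrt_op (spherical_modulus T) in
  fun k => Q \o spherical_polar_part T k \o Q.

Definition spherical_duggal T : 'I_d -> H -> H :=
  fun k => spherical_modulus T \o spherical_polar_part T k.

Definition spherical_mean T : 'I_d -> H -> H :=
  fun k x => 2^-1 *: (T k x + spherical_duggal T k x).

Definition spherical_lambda_mean (lambda : R) T : 'I_d -> H -> H :=
  fun k x => lambda%:C *: T k x + (1 - lambda)%:C *: spherical_duggal T k x.

End spherical.

(* Main.v *)
Require Import Defs.
From HB Require Import structures.
From mathcomp Require Import all_boot all_order all_algebra.
From mathcomp Require Import sesquilinear complex.
From mathcomp Require Import all_classical all_reals all_analysis.
From mathcomp Require Import ring lra.
Set Implicit Arguments.
Unset Strict Implicit.
Unset Printing Implicit Defensive.
Import Order.TTheory GRing.Theory Num.Theory.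
Import numFieldNormedType.Exports.
Local Open Scope classical_set_scope.
Local Open Scope ring_scope.
Local Open Scope complex_scope.

(** Write [P] for the modulus of [T], [Q] for the square root of [P] and [V] for
    the polar part of [T], so that [T k = V k \o P].  Where [P] has no square
    root or [T] no polar part, the chosen [Q] or [V] is zero by definition; then
    the Aluthge transform vanishes and the lower bound is immediate.  If [V] is
    zero, the Duggal transform vanishes as well, and its bound is immediate.

    The upper bounds come from [spherical_duggal_le].  The column operator [V]
    is a contraction because [sum_k (V k)^* (V k)] is an orthogonal projection,
    and [|P x|] is the norm of the tuple [T x] because this projection fixes the
    range of [P]; hence [|P V x| <= |T| |V x| <= |T| |x|].  The bound on the
    lambda-mean is then the triangle inequality.

    The lower bound is the arithmetic-geometric mean inequality for operators
    ([operator_agm]): for a self-adjoint [Q] and an arbitrary column [V],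
    [2 sqrt(lambda (1 - lambda)) |Q V Q| <= |lambda V Q^2 + (1 - lambda) Q^2 V|].
    Let [S = Q V Q], [s = |S|] and let [M] be the column on the right.  Were [s]
    attained at a unit vector [u], then [S^* S u = s^2 u], and with [y = S u],
    [<M Q u, Q y> = lambda s^2 |Q u|^2 + (1 - lambda) |Q y|^2], which is at least
    [2 sqrt(lambda (1 - lambda)) s |Q u| |Q y|] and at most [|M| |Q u| |Q y|].
    In general [s] is only approached, and the residual [S^* S u - s^2 u] has a
    squared norm of at most [s^2 (s^2 - |S u|^2)]; the same computation with this
    error term ([agm_residual]) keeps [|S u|] away from [s] if the inequality
    fails.

    The adjoints in these computations exist by the Riesz representation theorem
    ([riesz], [adjointP]).  Everything takes place in the real inner product
    [Re <x, y>], which determines the complex one. *)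

(** * The real inner product on vectors and tuples *)

Section real_inner.
Context {R : realType} {H : hilbertSpace R}.
Implicit Types x y z : H.

Definition rdot x y : R := complex.Re (inner H x y).

Lemma ReD (a b : R[i]) : complex.Re (a + b) = complex.Re a + complex.Re b.
Proof. by case: a; case: b. Qed.

Lemma Re_realM (c : R) (a : R[i]) : complex.Re (c%:C * a) = c * complex.Re a.
Proof. by case: a => u v /=; rewrite mul0r subr0. Qed.

Lemma inner_conj x y : inner H x y = (inner H y x)^*%C.
Proof. by rewrite hermC expr0 mul1r. Qed.

Lemma rdotC x y : rdot x y = rdot y x.
Proof. by rewrite /rdot inner_conj; case: (inner H y x). Qed.

Lemma rdotDl x y z : rdot (x + y) z = rdot x z + rdot y z.
Proof. by rewrite /rdot linearDl ReD. Qed.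

Lemma rdotDr x y z : rdot z (x + y) = rdot z x + rdot z y.
Proof. by rewrite !(rdotC z) rdotDl. Qed.

Lemma rdotZl (c : R) x y : rdot (c%:C *: x) y = c * rdot x y.
Proof. by rewrite /rdot linearZl_LR /= Re_realM. Qed.

Lemma rdotZr (c : R) x y : rdot x (c%:C *: y) = c * rdot x y.
Proof. by rewrite !(rdotC x) rdotZl. Qed.

Lemma rdotNl x y : rdot (- x) y = - rdot x y.
Proof. by rewrite -scaleN1r -[-1](rmorphN1 (real_complex R)) rdotZl mulN1r. Qed.

Lemma rdotNr x y : rdot x (- y) = - rdot x y.
Proof. by rewrite !(rdotC x) rdotNl. Qed.

Lemma rdot_sumr d (F : 'I_d -> H) x : rdot x (\sum_k F k) = \sum_k rdot x (F k).
Proof.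
apply: big_morph => [a b|]; first exact: rdotDr.
by rewrite -[0 : H]subr0 rdotDr rdotNr subrr.
Qed.

Lemma real_normE x : `|x| = (real_norm x)%:C.
Proof. by rewrite /real_norm RRe_real// ger0_real. Qed.

Lemma real_norm_ge0 x : 0 <= real_norm x.
Proof. by rewrite -ler0c -real_normE. Qed.

Lemma rdotxx x : rdot x x = real_norm x ^+ 2.
Proof. by rewrite /rdot inner_norm real_normE -rmorphXn. Qed.

Lemma real_normZ (c : R) x : real_norm (c%:C *: x) = `|c| * real_norm x.
Proof.
apply: (@pexpIrn _ 2) => //; rewrite ?nnegrE ?mulr_ge0 ?real_norm_ge0//.
by rewrite -rdotxx rdotZl rdotZr rdotxx exprMn real_normK ?num_real// mulrA.
Qed.

Lemma real_normN x : real_norm (- x) = real_norm x.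
Proof. by rewrite /real_norm normrN. Qed.

Lemma real_norm_eq0 x : (real_norm x == 0) = (x == 0).
Proof. by rewrite -(normr_eq0 x) real_normE -(inj_eq (@complexI R)). Qed.

Lemma rdot_i x y : rdot ((- 'i)%C *: x) y = complex.Im (inner H x y).
Proof.
by rewrite /rdot linearZl_LR /=; case: (inner H x y) => a b /=; ring.
Qed.

(** The imaginary part is recovered as [Re <- i x, y>], which is why agreement
    is required for every complex multiple of the first argument. *)
Lemma inner_rdot (x y x' y' : H) :
  (forall c : R[i], rdot (c *: x) y = rdot (c *: x') y') ->
  inner H x y = inner H x' y'.
Proof.
move=> h; apply/eqP; rewrite eq_complex -!rdot_i h eqxx andbT.
by have := h 1; rewrite !scale1r => /eqP.
Qed.

End real_inner.

(** A quadratic polynomial in [t] without negative values has a nonpositive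
    discriminant.  Both the Cauchy-Schwarz inequality and the Riesz theorem
    apply it to the restriction of a quadratic functional to a line. *)
Lemma discriminant_le (R : realFieldType) (a b p : R) : 0 <= a -> 0 <= b ->
  (forall t, 0 <= a ^+ 2 + 2 * t * p + t ^+ 2 * b ^+ 2) -> p <= a * b.
Proof.
move=> a0 b0 quad; have [b_eq0|b_neq0] := eqVneq b 0.
  rewrite b_eq0 mulr0 leNgt; apply/negP => p0.
  have := quad (- ((a ^+ 2 + 1) / (2 * p))).
  have -> : 2 * - ((a ^+ 2 + 1) / (2 * p)) * p = - (a ^+ 2 + 1).
    by field; rewrite gt_eqF.
  by rewrite b_eq0 expr0n mulr0; lra.
have bp : 0 < b by rewrite lt_def b_neq0.
rewrite leNgt; apply/negP => abp.
have := quad (- (p / b ^+ 2)).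
have -> : a ^+ 2 + 2 * - (p / b ^+ 2) * p + (- (p / b ^+ 2)) ^+ 2 * b ^+ 2
    = ((a * b) ^+ 2 - p ^+ 2) / b ^+ 2 by field.
rewrite pmulr_lge0 ?invr_gt0 ?exprn_gt0// subr_ge0 leNgt => /negP; apply.
by rewrite ltr_pXn2r ?nnegrE ?mulr_ge0// (le_trans _ (ltW abp))// mulr_ge0.
Qed.

Section tuples.
Context {R : realType} {H : hilbertSpace R} {d : nat}.
Implicit Types x y z : 'I_d -> H.

Definition tdot x y : R := \sum_k rdot (x k) (y k).
Definition tnorm x : R := Num.sqrt (\sum_k real_norm (x k) ^+ 2).

Lemma tdotC x y : tdot x y = tdot y x.
Proof. by apply: eq_bigr => k _; exact: rdotC. Qed.

Lemma tnorm_ge0 x : 0 <= tnorm x.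
Proof. exact: sqrtr_ge0. Qed.

Lemma tnorm0 : tnorm (fun=> 0) = 0.
Proof.
by rewrite /tnorm big1 ?sqrtr0// => k _; apply/eqP; rewrite sqrf_eq0 real_norm_eq0.
Qed.

Lemma tnorm_sqr x : tnorm x ^+ 2 = \sum_k real_norm (x k) ^+ 2.
Proof. by rewrite sqr_sqrtr// sumr_ge0// => k _; rewrite sqr_ge0. Qed.

Lemma tdotxx x : tdot x x = tnorm x ^+ 2.
Proof. by rewrite tnorm_sqr; apply: eq_bigr => k _; rewrite rdotxx. Qed.

Lemma tdotDl x y z : tdot (fun k => x k + y k) z = tdot x z + tdot y z.
Proof. by rewrite -big_split; apply: eq_bigr => k _; rewrite rdotDl. Qed.

Lemma tdotZl (c : R) x y : tdot (fun k => c%:C *: x k) y = c * tdot x y.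
Proof. by rewrite mulr_sumr; apply: eq_bigr => k _; rewrite rdotZl. Qed.

Lemma tnormZ (c : R) x : tnorm (fun k => c%:C *: x k) = `|c| * tnorm x.
Proof.
apply: (@pexpIrn _ 2) => //; rewrite ?nnegrE ?mulr_ge0 ?tnorm_ge0//.
by rewrite exprMn -!tdotxx tdotZl tdotC tdotZl mulrA real_normK ?num_real.
Qed.

Lemma tdot_le x y : tdot x y <= tnorm x * tnorm y.
Proof.
apply: discriminant_le; rewrite ?tnorm_ge0// => t.
pose z k := x k + t%:C *: y k.
suff <- : tdot z z = tnorm x ^+ 2 + 2 * t * tdot x y + t ^+ 2 * tnorm y ^+ 2.
  by rewrite tdotxx sqr_ge0.
rewrite {1}/z tdotDl tdotZl !(tdotC _ z) !tdotDl !tdotZl !tdotxx (tdotC y x).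
by ring.
Qed.

Lemma tnormD x y : tnorm (fun k => x k + y k) <= tnorm x + tnorm y.
Proof.
rewrite -(@ler_pXn2r _ 2) ?nnegrE ?addr_ge0 ?tnorm_ge0// -tdotxx.
rewrite tdotDl !(tdotC _ (fun k => x k + y k)) !tdotDl !tdotxx (tdotC y x).
by have := tdot_le x y; nra.
Qed.

Lemma tnorm_le (a : R) x y : 0 <= a ->
  (forall k, real_norm (x k) <= a * real_norm (y k)) -> tnorm x <= a * tnorm y.
Proof.
move=> a0 h; rewrite -(@ler_pXn2r _ 2) ?nnegrE ?mulr_ge0 ?tnorm_ge0//.
rewrite exprMn !tnorm_sqr mulr_sumr ler_sum// => k _.
by rewrite -exprMn ler_pXn2r ?nnegrE ?mulr_ge0 ?real_norm_ge0.
Qed.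

End tuples.

Section single_vectors.
Context {R : realType} {H : hilbertSpace R}.
Implicit Types x y : H.

Lemma tnorm1 x : tnorm (fun _ : 'I_1 => x) = real_norm x.
Proof. by rewrite /tnorm big_ord1 sqrtr_sqr ger0_norm ?real_norm_ge0. Qed.

Lemma rdot_le x y : rdot x y <= real_norm x * real_norm y.
Proof.
by have := tdot_le (fun _ : 'I_1 => x) (fun=> y); rewrite /tdot big_ord1 !tnorm1.
Qed.

Lemma real_normD x y : real_norm (x + y) <= real_norm x + real_norm y.
Proof. by have := tnormD (fun _ : 'I_1 => x) (fun=> y); rewrite !tnorm1. Qed.

Lemma rdot_inj x y : (forall z, rdot z x = rdot z y) -> x = y.
Proof.
move=> h; apply/eqP; rewrite -subr_eq0 -real_norm_eq0 -sqrf_eq0 -rdotxx.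
by rewrite rdotDr rdotNr h subrr.
Qed.

End single_vectors.

(** * Bounded operators and their adjoints *)

Section bounded_operators.
Context {R : realType} {H : hilbertSpace R}.
Implicit Types (x y z : H) (A B : H -> H).

Lemma bounded_opP A : bounded_op A <->
  linear A /\
  exists2 M : R, 0 <= M & forall x, real_norm (A x) <= M * real_norm x.
Proof.
split=> -[linA bA]; split=> //;
    pose f : {linear H -> H} := HB.pack A (GRing.isLinear.Build _ _ _ _ A linA).
- have /linear_boundedP/pinfty_ex_gt0[M M0 bM] : bounded_near f (nbhs 0) by [].
  have ME : M = (complex.Re M)%:C by rewrite RRe_real// gtr0_real.
  exists (complex.Re M) => [|x]; first by rewrite -ler0c -ME ltW.
  by have := bM x; rewrite !real_normE ME -rmorphM lecR.
- have [M M0 bM] := bA.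
  apply: (proj2 (linear_boundedP f)); exists M%:C; split.
    by rewrite ger0_real// ler0c.
  move=> c /ltW Mc x; apply: le_trans (ler_wpM2r _ Mc) => //.
  by rewrite !real_normE -rmorphM lecR bM.
Qed.

Section linear_op.
Variables (A : H -> H) (linA : linear A).

Let f : {linear H -> H} := HB.pack A (GRing.isLinear.Build _ _ _ _ A linA).

Lemma linop0 : A 0 = 0.
Proof. exact: (raddf0 f). Qed.

Lemma linopD x y : A (x + y) = A x + A y.
Proof. exact: (raddfD f). Qed.

Lemma linopZ (c : R[i]) x : A (c *: x) = c *: A x.
Proof. exact: (linearZ_LR f). Qed.

End linear_op.

Lemma cauchy_harmonic_cvg (u : nat -> H) :
  (forall n k, real_norm (u n - u k) <= n.+1%:R^-1 + k.+1%:R^-1) ->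
  exists b, forall e : R, 0 < e ->
    exists n, n.+1%:R^-1 < e /\ real_norm (b - u n) < e.
Proof.
move=> hu.
have /cvg_ex[b ub] : cvg (u @ \oo).
  apply: cauchy_cvg; apply: cauchy_exP => eps eps0.
  have epsE : eps = (complex.Re eps)%:C by rewrite RRe_real// gtr0_real.
  have e0 : 0 < complex.Re eps / 2 by rewrite divr_gt0// -ltcR -epsE.
  have [N _ hN] := near_infty_natSinv_lt (PosNum e0).
  exists (u N), N => // n /= Nn; rewrite -ball_normE /ball_ /= real_normE epsE ltcR.
  have hNN : N.+1%:R^-1 < complex.Re eps / 2 := hN N (leqnn N).
  have hNn : n.+1%:R^-1 < complex.Re eps / 2 := hN n Nn.
  by rewrite (le_lt_trans (hu N n))// (splitr (complex.Re eps)) ltrD.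
exists b => e e0.
have [N _ hN] := near_infty_natSinv_lt (PosNum e0).
have ec : 0 < e%:C by rewrite ltcR.
have [N' _ hN'] := (proj1 (@cvgrPdist_lt _ _ _ _ _ u b) ub) e%:C ec.
exists (maxn N N'); split; first exact: (hN _ (leq_maxl _ _)).
by have := hN' _ (leq_maxr N N'); rewrite /= real_normE ltcR.
Qed.

(** Riesz representation in the real inner product.  A vector [u] that minimises
    [g x = |x|^2 - 2 f x] up to [e^2] represents [f] up to [e]: along each line
    through [u], [g] is a quadratic polynomial that is bounded below, and its
    discriminant gives the estimate.  Two such vectors with errors [e] and [e']
    are at distance at most [e + e'], as one sees by testing them on their
    difference; so they converge, and the limit represents [f] exactly. *)
Lemma riesz (f : H -> R) (M : R) :
  (forall x y, f (x + y) = f x + f y) ->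
  (forall (c : R) x, f (c%:C *: x) = c * f x) ->
  (forall x, f x <= M * real_norm x) -> exists b, forall x, f x = rdot x b.
Proof.
move=> fD fZ fM.
pose g x := real_norm x ^+ 2 - 2 * f x.
have lbg : has_lbound (range g).
  exists (- M ^+ 2) => _ [x _ <-].
  by rewrite /g; have := fM x; have := sqr_ge0 (M - real_norm x); nra.
have near_min (e : R) : 0 < e ->
    exists u, forall w, rdot u w - f w <= e * real_norm w.
  move=> e0; have e20 : 0 < e ^+ 2 by rewrite exprn_gt0.
  have [|_ [u _ <-] gu] := inf_adherent e20 (conj _ lbg).
    by exists (g 0); exists 0.
  exists u => w; apply: discriminant_le => [||t].
    exact: ltW.
    exact: real_norm_ge0.
  have : g u - e ^+ 2 <= g (u + t%:C *: w).
    apply: le_trans (ge_inf lbg _); last by exists (u + t%:C *: w).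
    by rewrite lerBlDr ltW.
  rewrite /g -!rdotxx !(rdotDl, rdotDr, fD, fZ, rdotZl, rdotZr) (rdotC w u).
  by lra.
have inv_gt0 (n : nat) : 0 < n.+1%:R^-1 :> R by rewrite invr_gt0.
have [u hu] := choice (fun n => near_min _ (inv_gt0 n)).
have hu' n w : f w - rdot (u n) w <= n.+1%:R^-1 * real_norm w.
  have := hu n (- w); have := fZ (-1) w; have := real_normZ (-1) w.
  rewrite rmorphN1 scaleN1r => -> ->; rewrite normrN1 mul1r rdotNr.
  by move: n.+1%:R^-1 => a; lra.
have cauchy_u n k : real_norm (u n - u k) <= n.+1%:R^-1 + k.+1%:R^-1.
  have := hu n (u n - u k); have := hu' k (u n - u k).
  have := rdotxx (u n - u k); rewrite {1}rdotDl rdotNl.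
  have := real_norm_ge0 (u n - u k); set c := real_norm _.
  rewrite le_eqVlt => /orP[/eqP <- _ _ _|c0 h3 h2 h1].
    by rewrite addr_ge0 ?invr_ge0.
  rewrite -(ler_pM2r c0) mulrDl; apply: le_trans (lerD h1 h2).
  by rewrite expr2 in h3; lra.
have [b hb] := cauchy_harmonic_cvg cauchy_u.
exists b => x; apply/eqP; rewrite -subr_eq0 -normr_le0 leNgt; apply/negP => h.
have x0 := real_norm_ge0 x.
have [|n [ne bn]] := hb (`|f x - rdot x b| / (2 * (real_norm x + 1))).
  by rewrite divr_gt0// mulr_gt0// ltr_wpDl.
have := hu n x; have := hu' n x.
have := rdot_le x (b - u n); have := rdot_le (- x) (b - u n).
rewrite real_normN !rdotNl !rdotDr !rdotNr !(rdotC x (u n)).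
set e := _ / _ in ne bn *.
have eE : `|f x - rdot x b| = e * (2 * (real_norm x + 1)).
  by rewrite divfK// gt_eqF// mulr_gt0// ltr_wpDl.
have e0 : 0 < e by rewrite divr_gt0// mulr_gt0// ltr_wpDl.
have h1 : real_norm x * real_norm (b - u n) <= real_norm x * e.
  by rewrite ler_wpM2l// ltW.
have h2 : n.+1%:R^-1 * real_norm x <= e * real_norm x.
  by rewrite ler_wpM2r// ltW.
move: n.+1%:R^-1 h2 {ne} => a h2 k1 k2 k3 k4.
suff : `|f x - rdot x b| <= 2 * (e * real_norm x) by rewrite eE; lra.
by rewrite ler_norml; apply/andP; split; lra.
Qed.

(** The real Riesz theorem gives a real adjoint [B]; as [A] commutes with complex
    scalars, [B] is also the adjoint for the complex inner product. *)
Lemma adjointP A : bounded_op A -> is_adjoint A (adjoint A).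
Proof.
move=> bA; have [linA [M M0 hM]] := (proj1 (bounded_opP A) bA).
suff exB : exists B, is_adjoint A B by exact: (xgetPex (fun=> 0) exB).
have ex y : exists b, forall x, rdot (A x) y = rdot x b.
  apply: (@riesz _ (M * real_norm y)) => [x z|c x|x].
  - by rewrite linopD// rdotDl.
  - by rewrite linopZ// rdotZl.
  - by rewrite (le_trans (rdot_le _ _))// mulrAC ler_wpM2r ?real_norm_ge0.
have [B hB] := choice ex.
have iB x y : inner H (A x) y = inner H x (B y).
  by apply: inner_rdot => c; rewrite -linopZ.
exists B; split=> //; apply/bounded_opP; split.
  move=> c x y; apply: rdot_inj => z; congr complex.Re.
  by rewrite -iB !linearDr !linearZr_LR /= !iB.
exists M => // x.
have [->|nz] := eqVneq (real_norm (B x)) 0; first by rewrite mulr_ge0 ?real_norm_ge0.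
have np : 0 < real_norm (B x) by rewrite lt_def nz real_norm_ge0.
rewrite -(ler_pM2l np) -expr2 -rdotxx -hB (le_trans (rdot_le _ _))//.
by rewrite mulrA (mulrC _ M) ler_wpM2r ?real_norm_ge0.
Qed.

(** Polarisation: the sesquilinear form [<P x, y> - <x, P y>] vanishes on the
    diagonal, hence is antisymmetric; replacing [y] by [i y] shows that it is
    also symmetric. *)
Lemma positive_selfadjoint P : linear P -> positive_op P ->
  forall x y, inner H (P x) y = inner H x (P y).
Proof.
move=> linP posP.
pose f x y := inner H (P x) y - inner H x (P y).
have fxx x : f x x = 0.
  rewrite /f [X in _ - X]inner_conj; apply/eqP; rewrite subr_eq0; apply/eqP.
  have /ger0_Im := posP x; case: (inner H (P x) x) => a b /= ->.
  by rewrite oppr0.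
have fD x y z : f (x + y) z = f x z + f y z.
  by rewrite /f linopD// !linearDl; ring.
have fDr x y z : f z (x + y) = f z x + f z y.
  by rewrite /f linopD// !linearDr; ring.
have anti x y : f x y + f y x = 0.
  by have := fxx (x + y); rewrite fD !fDr !fxx add0r addr0.
move=> x y; apply/eqP; rewrite -subr_eq0 -/(f x y).
have := anti x ('i%C *: y).
have -> : f x ('i%C *: y) = - 'i%C * f x y.
  rewrite /f linopZ// !linearZr_LR /= -mulrBr; congr (_ * _).
  by apply/eqP; rewrite eq_complex /= oppr0 !eqxx.
have -> : f ('i%C *: y) x = 'i%C * f y x.
  by rewrite /f linopZ// !linearZl_LR /= -mulrBr.
move/eqP; rewrite mulNr addrC -mulrBr mulf_eq0 => /orP[|].
  by rewrite eq_complex /= oner_eq0 andbF.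
have /eqP := anti x y; rewrite addr_eq0 => /eqP ->.
by rewrite opprK -mulr2n mulrn_eq0 oppr_eq0.
Qed.

Lemma bounded_op0 : bounded_op (fun=> 0 : H).
Proof.
apply/bounded_opP; split; first by move=> c x y; rewrite scaler0 addr0.
exists 0 => // x; rewrite mul0r le_eqVlt; apply/orP; left.
by rewrite real_norm_eq0.
Qed.

Lemma bounded_op_comp A B : bounded_op A -> bounded_op B -> bounded_op (A \o B).
Proof.
move=> /bounded_opP[linA [M M0 hM]] /bounded_opP[linB [N N0 hN]].
apply/bounded_opP; split; first by move=> c x y /=; rewrite linB linA.
exists (M * N) => [|x /=]; first exact: mulr_ge0.
by rewrite (le_trans (hM _))// -mulrA ler_wpM2l.
Qed.

Lemma bounded_op_lin (a b : R) A B : bounded_op A -> bounded_op B ->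
  bounded_op (fun x => a%:C *: A x + b%:C *: B x).
Proof.
move=> /bounded_opP[linA [M M0 hM]] /bounded_opP[linB [N N0 hN]].
apply/bounded_opP; split.
  move=> c x y /=; rewrite linB linA !scalerDr !scalerA addrACA.
  by rewrite (mulrC c) (mulrC c).
exists (`|a| * M + `|b| * N) => [|x /=]; first by rewrite addr_ge0 ?mulr_ge0.
rewrite (le_trans (real_normD _ _))// !real_normZ mulrDl -!mulrA.
by rewrite lerD// ler_wpM2l.
Qed.

End bounded_operators.

(** * The spherical norm as a supremum over unit vectors *)

Section sup_norm.
Context {R : realType} {H : hilbertSpace R} {d : nat}.
Implicit Types (A : 'I_d -> H -> H) (x : H) (y : 'I_d -> H).

Lemma spherical_norm_ge0 A : 0 <= spherical_norm A.
Proof.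
rewrite /spherical_norm; set E := image _ _.
have [supE|/sup_out-> //] := pselect (has_sup E).
have [[t Et] ubE] := supE; apply: le_trans (ub_le_sup ubE Et).
by case: Et => x _ <-; exact: sqrtr_ge0.
Qed.

Lemma spherical_norm_le A (c : R) : 0 <= c ->
  (forall x, real_norm x = 1 -> tnorm (A^~ x) <= c) -> spherical_norm A <= c.
Proof.
move=> c0 h; rewrite /spherical_norm.
set E := image _ _; have [->|/set0P E0] := eqVneq E set0; first by rewrite sup0.
by apply: ge_sup => // _ [x /= x1 <-]; exact: h.
Qed.

Variables (A : 'I_d -> H -> H) (bA : forall k, bounded_op (A k)).

Let unit_values := [set tnorm (A^~ x) | x in [set x : H | real_norm x = 1]].

Lemma has_ubound_unit_values : has_ubound unit_values.
Proof.
have hM k : exists M : R, 0 <= M /\ forall x, real_norm (A k x) <= M * real_norm x.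
  by have /bounded_opP[_ [M]] := bA k; exists M.
have [M hM'] := choice hM.
exists (Num.sqrt (\sum_k M k ^+ 2)) => _ [x /= x1 <-].
apply: ler_wsqrtr; apply: ler_sum => k _; have [M0 Mk] := hM' k.
by rewrite ler_pXn2r ?nnegrE ?real_norm_ge0// (le_trans (Mk _))// x1 mulr1.
Qed.

Lemma tnorm_le_spherical_norm x : tnorm (A^~ x) <= spherical_norm A * real_norm x.
Proof.
have x0 := real_norm_ge0 x.
have [xz|xn0] := eqVneq (real_norm x) 0.
  have -> : x = 0 by apply/eqP; rewrite -real_norm_eq0 xz.
  have -> : A^~ 0 = (fun=> 0%:C *: (0 : H)).
    by apply: funext => k; rewrite linop0 ?scaler0//; have [] := bA k.
  by rewrite tnormZ normr0 mul0r mulr_ge0 ?spherical_norm_ge0 ?real_norm_ge0.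
have -> : A^~ x = (fun k => (real_norm x)%:C *: A k ((real_norm x)^-1%:C *: x)).
  apply: funext => k; rewrite linopZ; last by have [] := bA k.
  by rewrite scalerA -rmorphM mulfV// rmorph1 scale1r.
rewrite tnormZ ger0_norm// mulrC ler_wpM2r//.
apply: ub_le_sup; first exact: has_ubound_unit_values.
exists ((real_norm x)^-1%:C *: x) => //=.
by rewrite real_normZ ger0_norm ?invr_ge0// mulVf.
Qed.

(** The adjoint of [A] seen as a column operator from [H] to [H^d]. *)
Definition column_adjoint y : H := \sum_k adjoint (A k) (y k).

Lemma rdot_column_adjoint y x : rdot (column_adjoint y) x = tdot y (A^~ x).
Proof.
rewrite rdotC rdot_sumr; apply: eq_bigr => k _.
by have [_ adjA] := adjointP (bA k); rewrite [RHS]rdotC /rdot adjA.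
Qed.

Lemma column_adjoint_le y (a : R) : 0 <= a ->
  (forall x, tdot y (A^~ x) <= a * real_norm x) -> real_norm (column_adjoint y) <= a.
Proof.
move=> a0 h; have z0 := real_norm_ge0 (column_adjoint y).
have [->//|zn0] := eqVneq (real_norm (column_adjoint y)) 0.
have zp : 0 < real_norm (column_adjoint y) by rewrite lt_def zn0.
by rewrite -(ler_pM2r zp) -expr2 -rdotxx rdot_column_adjoint h.
Qed.

End sup_norm.

(** * The arithmetic-geometric mean inequality *)

Section agm.
Context {R : realType} {H : hilbertSpace R} {d : nat}.

(** If [C (s^2 - t^2) >= D t^4] for all [t] in a set, then [s] is not its
    supremum: near [s] the left side tends to 0, the right side to [D s^4]. *)
Lemma near_sup_gap (C D s : R) : 0 <= C -> 0 < D -> 0 < s ->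
  exists2 r, r < s & forall t, r < t -> C * (s ^+ 2 - t ^+ 2) < D * t ^+ 4.
Proof.
move=> C0 D0 s0.
(* If [s - e < t], then [s / 2 < t], so the right side exceeds [D s^4 / 16],
   and the left side is at most [2 C s e]; the second bound on [e] keeps this
   below [D s^4 / 16]. *)
pose e := Num.min (s / 2) (D * s ^+ 3 / (32 * (C + 1))).
have C1 : 0 < 32 * (C + 1) by lra.
have e0 : 0 < e.
  by rewrite lt_min; apply/andP; split; rewrite divr_gt0// mulr_gt0// exprn_gt0.
have [e1 e2] : e <= s / 2 /\ e * (32 * (C + 1)) <= D * s ^+ 3.
  split; first by rewrite ge_min lexx.
  by rewrite -ler_pdivlMr// ge_min lexx orbT.
exists (s - e) => [|t st]; first by lra.
have t0 : s / 2 < t by lra.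
have t4 : D * (s / 2) ^+ 4 < D * t ^+ 4.
  by rewrite ltr_pM2l// ltr_pXn2r// nnegrE; lra.
apply: le_lt_trans t4.
have st2 : s ^+ 2 - t ^+ 2 <= 2 * s * e by nra.
have : C * (s ^+ 2 - t ^+ 2) <= C * (2 * s * e) by rewrite ler_wpM2l.
move=> /le_trans; apply.
have : e * (32 * (C + 1)) * s <= D * s ^+ 3 * s by rewrite ler_wpM2r// ltW.
have -> : D * (s / 2) ^+ 4 = D * s ^+ 3 * s / 16 by field.
have : 0 < s * e by rewrite mulr_gt0.
by nra.
Qed.

Variables (Q : H -> H) (V : 'I_d -> H -> H) (lambda : R).
Hypotheses (bQ : bounded_op Q) (bV : forall k, bounded_op (V k)).
Hypothesis selfadj : forall x y, rdot (Q x) y = rdot x (Q y).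
Hypothesis lambda01 : 0 <= lambda <= 1.

Let S k := Q \o V k \o Q.
Let M k x := lambda%:C *: V k (Q (Q x)) + (1 - lambda)%:C *: Q (Q (V k x)).
Let bS k : bounded_op (S k).
Proof. by do 2!(apply: bounded_op_comp => //). Qed.
Let bM k : bounded_op (M k).
Proof.
apply: (@bounded_op_lin _ _ _ _ (V k \o (Q \o Q)) (Q \o Q \o V k));
  by do 2!(apply: bounded_op_comp => //).
Qed.

(** Let [y = S u], [w = S^* y] and let [e = w - s^2 u] be the residual.  Then
    [|w| <= s |y|] bounds [|e|^2] by [s^2 (s^2 - |y|^2)], and evaluating
    [<M Q u, Q y>] in two ways gives [(2 c s - m) |Q y| <= q |e|].  Finally
    [|y|^2 = <w, u> <= |w| <= K |Q y|] replaces [|Q y|] by [|y|^2]. *)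
Lemma agm_residual (q : R) (u : H) :
  let s := spherical_norm S in
  let m := spherical_norm M in
  let K := spherical_norm (fun k => V k \o Q) in
  let c := Num.sqrt (lambda - lambda ^+ 2) in
  0 <= q -> (forall x, real_norm (Q x) <= q * real_norm x) ->
  m < 2 * c * s -> real_norm u = 1 ->
  (2 * c * s - m) ^+ 2 * tnorm (S^~ u) ^+ 4 <=
     (K * q * s) ^+ 2 * (s ^+ 2 - tnorm (S^~ u) ^+ 2).
Proof.
move=> s m K c q0 hq ltm u1.
have sE : s = spherical_norm S by [].
have mE : m = spherical_norm M by [].
have KE : K = spherical_norm (fun k => V k \o Q) by [].
have cE : c = Num.sqrt (lambda - lambda ^+ 2) by [].
clearbody s m K c.
have linQ : linear Q by case: bQ.
set t := tnorm _; have t0 : 0 <= t := tnorm_ge0 _.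
have s0 : 0 <= s by rewrite sE spherical_norm_ge0.
have K0 : 0 <= K by rewrite KE spherical_norm_ge0.
have ts : t <= s by rewrite sE -[leRHS]mulr1 -u1; exact: tnorm_le_spherical_norm.
set y := S^~ u; set w := column_adjoint S y.
pose e := w - (s ^+ 2)%:C *: u.
set a := tnorm (fun k => Q (y k)); have a0 : 0 <= a := tnorm_ge0 _.
set b := real_norm (Q u); have b0 : 0 <= b := real_norm_ge0 _.
have wu : rdot w u = t ^+ 2 by rewrite rdot_column_adjoint// tdotxx.
have ws : real_norm w <= s * t.
  apply: column_adjoint_le => // [|x]; first exact: mulr_ge0.
  rewrite (le_trans (tdot_le _ _))// mulrC mulrAC ler_wpM2r// sE.
  exact: tnorm_le_spherical_norm.
have wK : real_norm w <= K * a.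
  apply: column_adjoint_le => // [|x]; first exact: mulr_ge0.
  have -> : tdot y (S^~ x) = tdot (fun k => Q (y k)) (fun k => (V k \o Q) x).
    by apply: eq_bigr => k _; rewrite selfadj.
  rewrite (le_trans (tdot_le _ _))// mulrC mulrAC ler_wpM2r// KE.
  by apply: tnorm_le_spherical_norm => k; exact: bounded_op_comp.
have tK : t ^+ 2 <= K * a.
  by rewrite -wu (le_trans (rdot_le _ _))// u1 mulr1.
have e_le : real_norm e ^+ 2 <= s ^+ 2 * (s ^+ 2 - t ^+ 2).
  rewrite -rdotxx /e !(rdotDl, rdotDr, rdotNl, rdotNr, rdotZl, rdotZr) !rdotxx.
  rewrite (rdotC u w) wu u1.
  have : real_norm w ^+ 2 <= (s * t) ^+ 2.
    by rewrite ler_pXn2r ?nnegrE ?mulr_ge0 ?real_norm_ge0.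
  by rewrite exprMn; lra.
have key : lambda * s ^+ 2 * b ^+ 2 + lambda * rdot (Q u) (Q e) +
    (1 - lambda) * a ^+ 2 <= m * b * a.
  have -> : lambda * s ^+ 2 * b ^+ 2 + lambda * rdot (Q u) (Q e) +
      (1 - lambda) * a ^+ 2 = tdot (M^~ (Q u)) (fun k => Q (y k)).
    rewrite tdotDl !tdotZl -(tdotxx (fun k => Q (y k))).
    congr (_ + _ * _).
    (* Moving one [Q] from the right turns [V k \o Q^3] into [S k \o Q^2]. *)
    have -> : tdot (fun k => V k (Q (Q (Q u)))) (fun k => Q (y k))
        = tdot y (S^~ (Q (Q u))).
      by rewrite tdotC; apply: eq_bigr => k _; rewrite selfadj.
    rewrite -rdot_column_adjoint// -/w rdotC selfadj.
    rewrite -[w](subrK ((s ^+ 2)%:C *: u)) -/e.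
    by rewrite (rdotDl e) (rdotZl _ u) -(selfadj u) rdotxx; ring.
  rewrite (le_trans (tdot_le _ _))// ler_wpM2r// mE.
  exact: tnorm_le_spherical_norm.
have amgm : 2 * c * s * a * b <= lambda * s ^+ 2 * b ^+ 2 + (1 - lambda) * a ^+ 2.
  have /andP[l0 l1] := lambda01.
  have [p [r [-> <- <-]]] : exists p r,
      [/\ c = p * r, p ^+ 2 = lambda & r ^+ 2 = 1 - lambda].
    exists (Num.sqrt lambda), (Num.sqrt (1 - lambda)).
    rewrite !sqr_sqrtr ?subr_ge0//; split=> //.
    by rewrite cE -sqrtrM//; congr Num.sqrt; ring.
  by have := sqr_ge0 (p * s * b - r * a); lra.
have Qe : - rdot (Q u) (Q e) <= b * (q * real_norm e).
  by rewrite -rdotNr (le_trans (rdot_le _ _))// ler_wpM2l// real_normN.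
have [tz|tn0] := eqVneq t 0.
  by rewrite tz !expr0n /= mulr0 subr0 mulr_ge0 ?sqr_ge0.
have tp : 0 < t by rewrite lt_def tn0.
have bp : 0 < b.
  rewrite lt_def b0 andbT; apply: contra_neq tn0 => /eqP.
  rewrite real_norm_eq0 => /eqP Qu0.
  have : t ^+ 2 = 0.
    rewrite /t tnorm_sqr big1// => k _; apply/eqP; rewrite sqrf_eq0 real_norm_eq0.
    by rewrite /S /= Qu0 !linop0//; case: (bV k).
  by move/eqP; rewrite sqrf_eq0 => /eqP.
have e0 := real_norm_ge0 e.
have step : (2 * c * s - m) * a <= q * real_norm e.
  rewrite -(ler_pM2l bp).
  have qe0 : 0 <= b * (q * real_norm e) by rewrite !mulr_ge0.
  have /andP[l0 l1] := lambda01.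
  have : - (lambda * rdot (Q u) (Q e)) <= lambda * (b * (q * real_norm e)).
    by rewrite -mulrN ler_wpM2l.
  have : lambda * (b * (q * real_norm e)) <= b * (q * real_norm e).
    by rewrite ler_piMl.
  by lra.
have D0 : 0 <= 2 * c * s - m by rewrite subr_ge0 ltW.
have {}step : (2 * c * s - m) * t ^+ 2 <= K * q * real_norm e.
  apply: (@le_trans _ _ ((2 * c * s - m) * (K * a))); first exact: ler_wpM2l.
  by rewrite mulrCA -(mulrA K) ler_wpM2l.
have -> : (2 * c * s - m) ^+ 2 * t ^+ 4 = ((2 * c * s - m) * t ^+ 2) ^+ 2 by ring.
apply: (@le_trans _ _ ((K * q * real_norm e) ^+ 2)).
  by rewrite ler_pXn2r ?nnegrE ?mulr_ge0 ?exprn_ge0.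
by rewrite [leLHS]exprMn [(K * q * s) ^+ 2]exprMn -[leRHS]mulrA ler_wpM2l ?sqr_ge0.
Qed.

(** The operator form of [2 sqrt(x y) <= x + y], with the weights [lambda] and
    [1 - lambda] attached to the right and the left factor [Q^2]. *)
Lemma operator_agm :
  2 * Num.sqrt (lambda - lambda ^+ 2) * spherical_norm S <= spherical_norm M.
Proof.
rewrite leNgt; apply/negP => ltm.
have /bounded_opP[_ [q q0 hq]] := bQ.
set c := Num.sqrt _ in ltm; set s := spherical_norm S in ltm.
set m := spherical_norm M in ltm.
have s0 : 0 < s.
  rewrite lt_def spherical_norm_ge0 andbT; apply: contraTneq ltm => ->.
  by rewrite mulr0 -leNgt spherical_norm_ge0.
set K := spherical_norm (fun k => V k \o Q).
have [||r rs hr] := @near_sup_gap ((K * q * s) ^+ 2) ((2 * c * s - m) ^+ 2) s _ _ s0.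
  exact: sqr_ge0.
  by rewrite exprn_gt0// subr_gt0.
have [E0|/set0P E0] :=
    eqVneq [set tnorm (S^~ x) | x in [set x : H | real_norm x = 1]] set0.
  by have := s0; rewrite /s /spherical_norm E0 sup0 ltxx.
have [_ [u /= u1 <-] /hr] := sup_gt E0 rs.
by apply/negP; rewrite -leNgt; apply: agm_residual.
Qed.

End agm.

(** * Square roots, projections and the polar part *)

Section square_root.
Context {R : realType} {H : hilbertSpace R}.
Implicit Types (A P : H -> H).

Lemma sqrt_opP A : is_sqrt_op A (sqrt_op A) \/ sqrt_op A = fun=> 0.
Proof.
rewrite /sqrt_op; case: xgetP => [P _ hP|_]; [by left|by right].
Qed.

Lemma bounded_sqrt_op A : bounded_op (sqrt_op A).
Proof. by have [[]|->] := sqrt_opP A; last exact: bounded_op0. Qed.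

Lemma sqrt_op_selfadjoint A x y : inner H (sqrt_op A x) y = inner H x (sqrt_op A y).
Proof.
have [[[linP _] posP _]|->] := sqrt_opP A; first exact: positive_selfadjoint.
by rewrite linear0l linear0r.
Qed.

End square_root.

Section projections.
Context {R : realType} {H : hilbertSpace R}.
Implicit Types (E P : H -> H) (M : set H).

Lemma orthoproj_le E M x : is_orthoproj E M -> rdot (E x) x <= real_norm x ^+ 2.
Proof.
move=> /(_ x)[ME /(_ _ ME) orthE].
have : rdot (E x) (x - E x) = 0 by rewrite /rdot orthE.
have := sqr_ge0 (real_norm (x - E x)); rewrite -(rdotxx (x - E x)).
rewrite !(rdotDl, rdotDr, rdotNl, rdotNr) !rdotxx (rdotC x (E x)).
by lra.
Qed.

Lemma orthoproj_id E M x : is_orthoproj E (orthocomp M) -> orthocomp M x -> E x = x.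
Proof.
move=> /(_ x)[ME ortho] Mx; apply/esym/eqP.
rewrite -subr_eq0 -real_norm_eq0 -sqrf_eq0 -rdotxx.
suff /ortho h : orthocomp M (x - E x) by rewrite /rdot h.
move=> y My; transitivity (inner H y x - inner H y (E x)); first exact: linearBr.
by rewrite (Mx y My) (ME y My) subrr.
Qed.

Lemma range_sub_orthocomp_ker P x :
  (forall x y, inner H (P x) y = inner H x (P y)) ->
  orthocomp (ker_op P) (P x).
Proof. by move=> selfP y Py0; rewrite -selfP Py0 linear0l. Qed.

End projections.

(** * The transforms *)

Section polar.
Context {R : realType} {H : hilbertSpace R} {d : nat}.
Variable T : 'I_d -> H -> H.

Let P := spherical_modulus T.
Let V := spherical_polar_part T.
Let Q := sqrt_op P.

Lemma spherical_polar_partP :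
  is_spherical_polar_part T V \/ V = fun _ _ => 0.
Proof.
rewrite /V /spherical_polar_part; case: xgetP => [W _ hW|_]; [by left|by right].
Qed.

Lemma sum_adjoint_mulE (A : 'I_d -> H -> H) x : (forall k, bounded_op (A k)) ->
  rdot (sum_adjoint_mul A x) x = tnorm (A^~ x) ^+ 2.
Proof. by move=> bA; rewrite -tdotxx -(rdot_column_adjoint bA). Qed.

Lemma bounded_polar_part k : bounded_op (V k).
Proof. by have [[]|->] := spherical_polar_partP; last exact: bounded_op0. Qed.

(** The squared norm of [V x] is [<E x, x>], where [E] is the projection
    [sum_k (V k)^* (V k)]. *)
Lemma polar_part_contraction x : tnorm (V^~ x) <= real_norm x.
Proof.
rewrite -(@ler_pXn2r _ 2) ?nnegrE ?tnorm_ge0 ?real_norm_ge0//.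
rewrite -sum_adjoint_mulE; last exact: bounded_polar_part.
have [[_ _ projE]|V0] := spherical_polar_partP; first exact: orthoproj_le projE.
rewrite sum_adjoint_mulE; last exact: bounded_polar_part.
by rewrite V0 tnorm0 expr0n sqr_ge0.
Qed.

(** [V] is isometric on the range of [P], since the projection
    [sum_k (V k)^* (V k)] fixes that range. *)
Lemma real_norm_modulus x : is_spherical_polar_part T V ->
  real_norm (P x) = tnorm (T^~ x).
Proof.
move=> [bV TV projE].
have -> : T^~ x = V^~ (P x) by apply: funext => k; rewrite TV.
apply: (@pexpIrn _ 2) => //; rewrite ?nnegrE ?tnorm_ge0 ?real_norm_ge0//.
rewrite -sum_adjoint_mulE// (orthoproj_id projE) ?rdotxx//.
by apply: range_sub_orthocomp_ker; exact: sqrt_op_selfadjoint.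
Qed.

Lemma bounded_duggal k : bounded_op (spherical_duggal T k).
Proof.
by apply: bounded_op_comp; [exact: bounded_sqrt_op|exact: bounded_polar_part].
Qed.

(** [|P V x| <= |T| |V x|], since [|P z|] is the norm of the tuple [T z]. *)
Lemma spherical_duggal_le : (forall k, bounded_op (T k)) ->
  spherical_norm (spherical_duggal T) <= spherical_norm T.
Proof.
move=> bT; have T0 := spherical_norm_ge0 T.
apply: spherical_norm_le => // x x1.
have [polV|V0] := spherical_polar_partP; last first.
  suff -> : (spherical_duggal T)^~ x = fun=> 0 by rewrite tnorm0.
  apply: funext => k; rewrite /spherical_duggal /= -/V V0 linop0//.
  by have [] := bounded_sqrt_op (sum_adjoint_mul T).
apply: le_trans (_ : spherical_norm T * tnorm (V^~ x) <= _).
  apply: tnorm_le => // k.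
  by rewrite [leLHS]real_norm_modulus// tnorm_le_spherical_norm.
by rewrite -[leRHS]mulr1 ler_wpM2l// -x1 polar_part_contraction.
Qed.

(** The mean inequality for [P = Q \o Q]; without a square root of [P] or a
    polar part of [T], the Aluthge transform is zero. *)
Lemma spherical_aluthge_le (lambda : R) : 0 <= lambda <= 1 ->
  2 * Num.sqrt (lambda - lambda ^+ 2) * spherical_norm (spherical_aluthge T)
  <= spherical_norm (spherical_lambda_mean lambda T).
Proof.
move=> l01.
have aluthge0 : spherical_aluthge T = (fun _ _ => 0) ->
    2 * Num.sqrt (lambda - lambda ^+ 2) * spherical_norm (spherical_aluthge T)
    <= spherical_norm (spherical_lambda_mean lambda T).
  move=> ->; apply: (@le_trans _ _ 0); last exact: spherical_norm_ge0.
  rewrite mulr_ge0_le0 ?mulr_ge0 ?sqrtr_ge0//; apply: spherical_norm_le => // x _.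
  by rewrite tnorm0.
have [[_ _ QQ]|Q0] := sqrt_opP P; last first.
  apply: aluthge0; apply: funext => k; apply: funext => x.
  by rewrite /spherical_aluthge /= Q0.
have [[_ TV _]|V0] := spherical_polar_partP; last first.
  apply: aluthge0; apply: funext => k; apply: funext => x.
  by rewrite /spherical_aluthge /= -/V V0 linop0//; have [] := bounded_sqrt_op P.
have -> : spherical_lambda_mean lambda T = fun k x =>
    lambda%:C *: V k (Q (Q x)) + (1 - lambda)%:C *: Q (Q (V k x)).
  apply: funext => k; apply: funext => x.
  by rewrite /spherical_lambda_mean /spherical_duggal TV -/P -/V -QQ.
apply: operator_agm => //; first exact: bounded_sqrt_op.
  exact: bounded_polar_part.
by move=> x y; rewrite /rdot sqrt_op_selfadjoint.
Qed.

Lemma spherical_lambda_mean_le (lambda : R) : (forall k, bounded_op (T k)) ->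
  0 <= lambda <= 1 ->
  spherical_norm (spherical_lambda_mean lambda T)
  <= lambda * spherical_norm T + (1 - lambda) * spherical_norm (spherical_duggal T).
Proof.
move=> bT /andP[l0 l1]; have l1' : 0 <= 1 - lambda by rewrite subr_ge0.
apply: spherical_norm_le => [|x x1].
  by rewrite addr_ge0 ?mulr_ge0 ?spherical_norm_ge0.
rewrite (le_trans (tnormD _ _))// !tnormZ !ger0_norm// lerD// ler_wpM2l//.
  by rewrite -[leRHS]mulr1 -x1 tnorm_le_spherical_norm.
by rewrite -[leRHS]mulr1 -x1 tnorm_le_spherical_norm//; exact: bounded_duggal.
Qed.

Lemma spherical_meanE : spherical_mean T = spherical_lambda_mean 2^-1 T.
Proof.
apply: funext => k; apply: funext => x.
rewrite /spherical_mean /spherical_lambda_mean scalerDr.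
have -> : 1 - 2^-1 = 2^-1 :> R by field.
by have -> : (2^-1 : R)%:C = 2^-1 by rewrite fmorphV rmorph_nat.
Qed.

End polar.

Theorem theorem2p5 (R : realType) (H : hilbertSpace R)
    (Hsep : separable_space H) (d : nat) (T : 'I_d -> H -> H)
    (T_bounded : forall k, bounded_op (T k)) :
  (forall lambda : R, 0 <= lambda <= 1 ->
    [/\ 2 * Num.sqrt (lambda - lambda ^+ 2) *
          spherical_norm (spherical_aluthge T)
        <= spherical_norm (spherical_lambda_mean lambda T),
        spherical_norm (spherical_lambda_mean lambda T)
        <= lambda * spherical_norm T +
           (1 - lambda) * spherical_norm (spherical_duggal T)
      & lambda * spherical_norm T +
          (1 - lambda) * spherical_norm (spherical_duggal T)
        <= spherical_norm T]) /\
  (spherical_norm (spherical_aluthge T) <= spherical_norm (spherical_mean T)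
     <= spherical_norm T).
Proof.
have le_T lambda : 0 <= lambda <= 1 -> lambda * spherical_norm T +
    (1 - lambda) * spherical_norm (spherical_duggal T) <= spherical_norm T.
  move=> /andP[l0 l1]; have := spherical_duggal_le T_bounded.
  by rewrite -(subr_ge0 lambda) in l1; move=> /(ler_wpM2l l1); lra.
split=> [lambda l01|].
  split; [exact: spherical_aluthge_le|exact: spherical_lambda_mean_le|exact: le_T].
have half01 : 0 <= (2^-1 : R) <= 1 by apply/andP; split; lra.
rewrite spherical_meanE; apply/andP; split; last first.
  exact: le_trans (spherical_lambda_mean_le T_bounded half01) (le_T _ half01).
have := spherical_aluthge_le T half01.
have -> : 2^-1 - 2^-1 ^+ 2 = 2^-1 ^+ 2 :> R by field.
by rewrite sqrtr_sqr ger0_norm ?invr_ge0// mulfV// mul1r.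
Qed.
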